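(* Let $t\geq 3$ be an odd integer such that $t\not\equiv 1\pmod{10}$ and $t\not\equiv 15\pmod{18}$, and let $S_t=\{1,\dots,2t+1\}\setminus\{t\}$. Then the circulant graph $\mathrm{Circ}(n,S_t)$ is a nut graph for each even $n\geq 4t+4$.
   Context: For $n\in\mathbb{N}$ and a generator set $S\subseteq\{1,\dots,\lfloor n/2\rfloor\}$, $\mathrm{Circ}(n,S)$ denotes the circulant graph with vertex set $V=\{0,1,\dots,n-1\}$ in which $i$ is adjacent to $i\pm s$ (computed modulo $n$) for every $i\in V$ and $s\in S$. A simple graph with at least two vertices is a nut graph if its adjacency matrix has the eigenvalue $0$ with multiplicity exactly $1$ and an eigenvector corresponding to $0$ has no zero entries. *)

(* Defs.v *)
From mathcomp Require Import all_boot all_order all_algebra.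

Set Implicit Arguments.
Unset Strict Implicit.
Unset Printing Implicit Defensive.

Import Order.TTheory GRing.Theory Num.Theory.
Local Open Scope ring_scope.

(* Generators are meant to satisfy 1 <= s <= n./2. The second congruence reads
   j = i - s modulo n, phrased without the truncated subtraction of nat. *)
Definition circ (n : nat) (S : seq nat) : rel 'I_n :=
  fun i j => has (fun s => (j == i + s %[mod n])%N || (j + s == i %[mod n])%N) S.

Definition adjmx (R : rcfType) (n : nat) (e : rel 'I_n) : 'M[R]_n :=
  \matrix_(i, j) (e i j)%:R.

Definition simple_graph (n : nat) (e : rel 'I_n) : Prop :=
  symmetric e /\ irreflexive e.

(* The multiplicity of the eigenvalue 0 is its multiplicity as a root of the
   characteristic polynomial; adjmx being symmetric, it equals the dimension of
   the kernel. As that kernel is then a line, one nowhere zero vector in it is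
   the same as all its nonzero vectors being nowhere zero. *)
Definition nut_graph (R : rcfType) (n : nat) (e : rel 'I_n) : Prop :=
  [/\ simple_graph e, (2 <= n)%N, mup 0 (char_poly (adjmx R e)) = 1%N
    & exists2 v : 'cV[R]_n, adjmx R e *m v = 0 & forall i, v i 0 != 0].

Definition gens (t : nat) : seq nat := [seq s <- iota 1 (2 * t + 1) | s != t].

(* Main.v *)
(** The eigenvalues are [lam x = \sum_(s in S_t) (x^s + x^-s)] for [x^n = 1], and
    [x^(2t+1) (x - 1) lam x = P(x, x^t)] with
    [P(w, u) = w^3 u^4 - 1 - w (w - 1) u (u^2 + u + 1)].  One has [lam (-1) = 0]
    and [lam 1 != 0]; let [x != 1, -1] be a root of unity of order [N] with
    [u = x^t] and [P(x, u) = 0].  As [t] is odd, some Galois conjugation sends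
    [(x, u)] to [(-x, -u)] if [4 | N], to [(x^2, u^2)] if [N] is odd, and to
    [(-x^2, -u^2)] if [N = 2 mod 4], which gives a second equation.
    - [P(x, u) = P(-x, -u) = 0] forces [x^2 = 1].
    - If [P(x, u) = 0] then [P(x^2, u^2) = - (x^3 u^4 - 1) P(-x, -u)], so that
      [x^3 u^4 = 1], whence [u^2 + u + 1 = 0]; then [x] has order 9 and
      [t = 15 mod 18].
    - With [w = -x] and [v = -u], eliminating in the third case leaves
      [(v - 1)^2 (w - v) (w v - 1) = 0]; then [w = v] has order 5 and
      [t = 1 mod 10]. *)
Require Import Defs.
From mathcomp Require Import all_boot all_order all_algebra all_field zify ring.

Set Implicit Arguments.
Unset Strict Implicit.
Unset Printing Implicit Defensive.
Import GRing.Theory Num.Theory.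
Local Open Scope ring_scope.

(** * The curve [P(w, u) = 0] and its conjugate equations *)

Definition curve (F : pzRingType) (w u : F) : F :=
  w ^+ 3 * u ^+ 4 - 1 - w * (w - 1) * u * (u ^+ 2 + u + 1).

(** Sum and difference of the equations isolate the parts of even and odd total degree; these
    combine to [w (u^2 + 1) (u^2 - 1) = 0]. *)
Lemma curve_opp (F : numFieldType) (w u : F) :
  w != 0 -> u != 0 -> curve w u = 0 -> curve (- w) (- u) = 0 -> w ^+ 2 = 1.
Proof.
move=> w0 u0 P1 P2.
have two0 : (2 : F) != 0 by rewrite pnatr_eq0.
have even0 : 1 + w ^+ 2 * u ^+ 2 - w * u * (u ^+ 2 + 1) = 0.
  apply: (mulfI two0); rewrite mulr0.
  transitivity (- (curve w u + curve (- w) (- u))); first by rewrite /curve; ring.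
  by rewrite P1 P2; ring.
have odd0 : u * (1 + w ^+ 2 * u ^+ 2) - w * (u ^+ 2 + 1) = 0.
  apply: (mulfI (mulf_neq0 two0 (mulf_neq0 w0 u0))); rewrite mulr0.
  transitivity (curve w u - curve (- w) (- u)); first by rewrite /curve; ring.
  by rewrite P1 P2; ring.
have /eqP : w * (u ^+ 2 + 1) * (u ^+ 2 - 1) = 0.
  transitivity ((u * (1 + w ^+ 2 * u ^+ 2) - w * (u ^+ 2 + 1))
     - u * (1 + w ^+ 2 * u ^+ 2 - w * u * (u ^+ 2 + 1))); first by ring.
  by rewrite even0 odd0; ring.
rewrite !mulf_eq0 (negPf w0) /= => /orP[/eqP u2|/eqP u2].
- have : 1 - w ^+ 2 = 0.
    transitivity (1 + w ^+ 2 * u ^+ 2 - w * u * (u ^+ 2 + 1)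
       + (u ^+ 2 + 1) * (w * u - w ^+ 2)); first by ring.
    by rewrite even0 u2; ring.
  by move/subr0_eq.
have /eqP : (w - u) ^+ 2 = 0.
  transitivity (1 + w ^+ 2 * u ^+ 2 - w * u * (u ^+ 2 + 1)
     - (u ^+ 2 - 1) * (w ^+ 2 - 1 - w * u)); first by ring.
  by rewrite even0 u2; ring.
by rewrite expf_eq0 subr_eq0 /= => /eqP ->; apply: subr0_eq.
Qed.

(** Both terms of [curve] split at squares, by [a^2 - 1 = (a - 1) (a + 1)] and [u^4 + u^2 + 1 = (u^2
    + u + 1) (u^2 - u + 1)]; up to sign, the factors are the terms at [(w, u)] and [(-w, -u)]. *)
Lemma curve_sqr (F : comPzRingType) (w u : F) : curve w u = 0 ->
  curve (w ^+ 2) (u ^+ 2) = - (w ^+ 3 * u ^+ 4 - 1) * curve (- w) (- u).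
Proof.
move=> P1.
transitivity (- (w ^+ 3 * u ^+ 4 - 1) * curve (- w) (- u)
  + curve w u * (w * (w + 1) * u * (u ^+ 2 - u + 1))).
  by rewrite /curve; ring.
by rewrite P1; ring.
Qed.

Lemma curve_opp_sqr (F : numFieldType) (w u : F) : w != 0 -> u != 0 ->
  curve (- w) (- u) = 0 -> curve (- w ^+ 2) (- u ^+ 2) = 0 ->
  [|| u == 1, w == u | w * u == 1].
Proof.
move=> w0 u0 P1 P2.
have c0 : 2 * w ^+ 2 * u ^+ 2 != 0 by rewrite !mulf_neq0 ?expf_neq0 ?pnatr_eq0.
have /eqP : (u - 1) ^+ 2 * ((w - u) * (w * u - 1)) = 0.
  apply: (mulfI c0); rewrite mulr0.
  (* With [C = w (w + 1) u (u^2 - u + 1)] and [E = w^3 u^4 + 1], [curve (- w) (- u)] is [C - E]; the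
     cofactor [C + E] brings in [E^2 - C^2], which cancels [w^6 u^8 + 1]. *)
  transitivity (curve (- w ^+ 2) (- u ^+ 2) - curve (- w) (- u) *
     (w ^+ 3 * u ^+ 4 + 1 + w * (w + 1) * u * (u ^+ 2 - u + 1))).
    by rewrite /curve; ring.
  by rewrite P1 P2; ring.
by rewrite mulf_eq0 expf_eq0 /= mulf_eq0 !subr_eq0.
Qed.

(** Put into the first equation, [u = 1] and [w u = 1] each leave [(w + 1) (w - 1)^2 = 0], and
    [u = w] leaves [(w^2 - 1) (w^5 - 1) = 0]. *)
Lemma curve_opp_torsion (F : numFieldType) (w u : F) : w != 0 -> u != 0 ->
  curve (- w) (- u) = 0 -> curve (- w ^+ 2) (- u ^+ 2) = 0 ->
  w ^+ 2 = 1 \/ w ^+ 5 = 1 /\ u = w.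
Proof.
move=> w0 u0 P1 P2.
have sq1 : (w + 1) * (w - 1) ^+ 2 = 0 -> w ^+ 2 = 1.
  move/eqP; rewrite mulf_eq0 expf_eq0 /= subr_eq0 addr_eq0.
  by case/orP=> /eqP ->; rewrite ?sqrrN expr1n.
case/or3P: (curve_opp_sqr w0 u0 P1 P2) => /eqP E.
- by left; apply: sq1; rewrite -[RHS]oppr0 -P1 E /curve; ring.
- have : (w ^+ 2 - 1) * (w ^+ 5 - 1) = 0.
    by rewrite -[RHS]oppr0 -P1 -E /curve; ring.
  move/eqP; rewrite mulf_eq0 !subr_eq0 => /orP[|] /eqP ->; first by left.
  by right.
left; apply: sq1.
transitivity (w ^+ 2 * curve (- w) (- u)); last by rewrite P1 mulr0.
have -> : u = w^-1 by rewrite -[LHS](mulKf w0) E mulr1.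
by rewrite /curve; field.
Qed.

(** * Roots of unity on the curve *)

Lemma curve_conj (w : algC) (N k t : nat) : w ^+ N = 1 -> coprime k N ->
  curve w (w ^+ t) = 0 -> curve (w ^+ k) ((w ^+ k) ^+ t) = 0.
Proof.
(* [f] raises [N]-th roots of unity to the power [k], and [curve] has integer coefficients. *)
move=> wN /Qn_aut_exists[f fE] P1.
by rewrite -fE // -rmorphXn -(rmorph0 f) -P1 /curve
  !(rmorphB, rmorphM, rmorphD, rmorphXn, rmorph1).
Qed.

Lemma curve_root_of_unity (w : algC) (n t : nat) :
  (0 < n)%N -> odd t -> t != 1 %[mod 10] -> t != 15 %[mod 18] ->
  w ^+ n = 1 -> w != 1 -> curve w (w ^+ t) = 0 -> w = -1.
Proof.
move=> n_gt0 odd_t t10 t18 wn w1 P1.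
suff /eqP : w ^+ 2 = 1 by rewrite sqrf_eq1 (negPf w1) => /eqP.
have [N Nw _] := prim_order_exists n_gt0 wn.
have N_gt0 := prim_order_gt0 Nw; have wN := prim_expr_order Nw.
have w0 : w != 0 
  by apply/eqP => E; move/eqP: wN; rewrite E expr0n gtn_eqF //= eq_sym oner_eq0.
have u0 : w ^+ t != 0 by rewrite expf_neq0.
have N1 : N != 1%N by apply: contra_neq w1 => NE; rewrite -[w]expr1 -NE.
have half : ~~ odd N -> w ^+ N./2 = -1.
  move=> evN; have /eqP : w ^+ N./2 ^+ 2 = 1 by rewrite -exprM muln2 even_halfK.
  rewrite sqrf_eq1 -(prim_order_dvd Nw) gtnNdvd => [/eqP|| ] //; lia.
case: (boolP (odd N)) => [oddN|evN].
- have co2 : coprime 2 N by rewrite coprime2n.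
  have := curve_conj wN co2 P1; rewrite -exprM mulnC exprM (curve_sqr P1) => /eqP.
  rewrite mulf_eq0 oppr_eq0 => /orP[|/eqP P2]; last exact: curve_opp P1 P2.
  move=> E; move: P1; rewrite /curve (eqP E) sub0r => /eqP.
  rewrite oppr_eq0 !mulf_eq0 (negPf w0) subr_eq0 (negPf w1) (negPf u0) /= => /eqP uu.
  have u3 : (w ^+ t) ^+ 3 = 1.
    apply: subr0_eq; transitivity ((w ^+ t - 1) * ((w ^+ t) ^+ 2 + w ^+ t + 1)); first by ring.
    by rewrite uu mulr0.
  have dv3 : (N %| t + 3)%N.
    rewrite (prim_order_dvd Nw) exprD; move: E; rewrite (exprS _ 3) u3 mulr1 subr_eq0.
    by rewrite mulrC.
  (* [9 = 3 (t + 3) - 3 t]. *)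
  have dv9 : (N %| 9)%N.
    have dv3t : (N %| t * 3)%N by rewrite (prim_order_dvd Nw) exprM u3.
    by rewrite -[9%N]/(3 * 3)%N -(dvdn_addr _ dv3t) -mulnDl dvdn_mulr.
  (* Order 3 would give [u = 1], against [u^2 + u + 1 = 0]; order 9 with [9 | t + 3] and [t] odd
     gives the excluded residue 15. *)
  move: dv9; rewrite dvdn_divisors // !inE (negPf N1) /= => /orP[] /eqP NE.
    move: dv3; rewrite NE dvdn_addl // -NE (prim_order_dvd Nw) => /eqP wt.
    by move/eqP: uu; rewrite wt expr1n -[1]/1%:R -!natrD pnatr_eq0.
  by move: dv3; rewrite NE; lia.
have oddX (a : algC) : (- a) ^+ t = - a ^+ t by rewrite exprNn -signr_odd odd_t mulN1r.
have NE : (N = N./2 * 2)%N by rewrite muln2 even_halfK.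
case: (boolP (odd N./2)) => [oddm|evm].
  (* As [w^(N/2) = -1], this exponent sends [w] to [-w^2]; it is odd, and prime to the odd number
     [N/2]. *)
  have cok : coprime (N./2 + 2) N.
    by rewrite {2}NE coprimeMr coprimen2 oddD oddm coprime_sym /coprime gcdnDl
      andbT -/(coprime _ _) coprimen2.
  have := curve_conj wN cok P1.
  rewrite exprD half // mulN1r oddX -exprM mulnC exprM -(sqrrN w)
    -(sqrrN (w ^+ t)) => P2; rewrite sqrrN.
  have := @curve_opp_torsion _ (- w) (- w ^+ t).
  rewrite !oppr_eq0 !opprK => /(_ w0 u0 P1 P2)[|[w5 /oppr_inj wt]].
    by rewrite sqrrN.
  have dv10 : (N %| 10)%N.
    by rewrite (prim_order_dvd Nw) -[10%N]/(2 * 5)%N exprM -sqrrN -exprM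
      mulnC exprM w5 expr1n.
  have dvt : (N %| t - 1)%N.
    rewrite (prim_order_dvd Nw) -(inj_eq (mulIf w0)) mul1r -exprSr.
    by rewrite subn1 prednK ?odd_gt0 // wt.
  (* Order 2 is the goal, order 5 is odd, and order 10 would give [t = 1 mod 10]. *)
  move: dv10; rewrite dvdn_divisors // !inE (negPf N1) /=.
  case/or3P=> /eqP E; [by rewrite E in wN | by rewrite E in evN | by lia].
have cok : coprime (N./2 + 1) N.
  by rewrite {2}NE coprimeMr coprimen2 oddD (negPf evm) coprime_sym /coprime gcdnDl gcdn1.
have := curve_conj wN cok P1.
by rewrite exprD half // mulN1r oddX; apply: curve_opp.
Qed.

(** * Circulant adjacency and Fourier vectors *)

Lemma modn_eq_add (n i j s : nat) : (i < n)%N -> (j < n)%N -> (s < n)%N ->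
  (j == i + s %[mod n])%N = (j == i + s)%N || (j + n == i + s)%N.
Proof.
move=> i_n j_n s_n; rewrite (modn_small j_n).
have [is_n|n_is] := ltnP (i + s)%N n; first by rewrite modn_small //; lia.
by rewrite -{1}(subnK n_is) modnDr modn_small; lia.
Qed.

Lemma circ_one_side (n i j s : nat) :
  (i < n)%N -> (j < n)%N -> (0 < s)%N -> (s.*2 < n)%N ->
  (j == i + s %[mod n])%N -> (j + s == i %[mod n])%N -> False.
Proof.
move=> i_n j_n s_gt0; rewrite -addnn => s_n.
have s_n' : (s < n)%N := leq_ltn_trans (leq_addr s s) s_n.
rewrite [(_ + _ == i %[mod n])%N]eq_sym !modn_eq_add //.
by case/orP=> /eqP ? /orP[] /eqP ?; lia.
Qed.

(** A common neighbour makes [n] divide [s - s'] or [s + s'], both below [n] in absolute value. *)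
Lemma circ_generator_inj (n i j s s' : nat) :
  (i < n)%N -> (j < n)%N -> (s.*2 < n)%N -> (s'.*2 < n)%N ->
  (0 < s)%N -> (0 < s')%N ->
  (j == i + s %[mod n])%N || (j + s == i %[mod n])%N ->
  (j == i + s' %[mod n])%N || (j + s' == i %[mod n])%N -> s = s'.
Proof.
move=> i_n j_n; rewrite -!addnn => s_n s'_n s_gt0 s'_gt0.
have s_n2 : (s < n)%N := leq_ltn_trans (leq_addr s s) s_n.
have s'_n2 : (s' < n)%N := leq_ltn_trans (leq_addr s' s') s'_n.
rewrite ![(_ + _ == i %[mod n])%N]eq_sym !modn_eq_add //.
by case/orP=> /orP[] /eqP ? /orP[] /orP[] /eqP ?; lia.
Qed.

(** Row [i] of the eigenvector equation for the Fourier vector [(x^j)]. The bounds on [S] make the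
    neighbours [i + s] and [i - s] all distinct, so [has] becomes a sum of indicators. *)
Lemma sum_circ (R : pzRingType) (n : nat) (S : seq nat) (x : R) (i : 'I_n) :
  x ^+ n = 1 -> uniq S -> all (fun s => (0 < s)%N && (s.*2 < n)%N) S ->
  \sum_(j < n) (circ S i j)%:R * x ^+ j
    = (\sum_(s <- S) (x ^+ s + x ^+ (n - s))) * x ^+ i.
Proof.
move=> xn; elim: S => [|s S IHS] /=.
  by move=> _ _; rewrite big_nil mul0r big1 // => j _; rewrite mul0r.
move=> /andP[sS uS] /andP[/andP[s_gt0 s_n] aS].
have i_n := ltn_ord i; have n_gt0 : (0 < n)%N by lia.
rewrite big_cons mulrDl -IHS //.
have sum1 m : \sum_(j < n) (j == m %[mod n])%:R * x ^+ j = x ^+ m.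
  rewrite (bigD1 (Ordinal (ltn_pmod m n_gt0))) //= modn_mod eqxx mul1r.
  rewrite big1 ?addr0 => [|j /eqP jm].
    by rewrite [in RHS](divn_eq m n) exprD mulnC exprM xn expr1n mul1r.
  case: eqP => [E|_]; last by rewrite mul0r.
  by case: jm; apply: val_inj; rewrite /= -E modn_small.
rewrite mulrDl -!exprD -(sum1 (s + i)%N) -(sum1 (n - s + i)%N) -!big_split /=.
apply: eq_bigr => j _; rewrite -!mulrDl -!natrD; congr (_%:R * _).
have j_n := ltn_ord j.
have -> : (j == n - s + i %[mod n])%N = (j + s == i %[mod n])%N.
  rewrite -(eqn_modDr s) -addnA [(i + s)%N]addnC addnA subnK; last by lia.
  by rewrite modnDl.
rewrite [(s + i)%N]addnC /circ /=.
have disj : ~~ ((j == i + s %[mod n])%N && (j + s == i %[mod n])%N).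
  by apply/negP=> /andP[]; apply: circ_one_side.
have disjS : has (fun s => (j == i + s %[mod n])%N || (j + s == i %[mod n])%N) S ->
    ~~ ((j == i + s %[mod n])%N || (j + s == i %[mod n])%N).
  case/hasP=> s' s'S near'; have /andP[s'_gt0 s'_n] := allP aS _ s'S.
  by apply: contra sS => near; rewrite (@circ_generator_inj n i j s s').
by move: disj disjS; case: (j == _ %[mod n])%N;
  case: (_ == i %[mod n])%N; case: has => // _ /(_ isT).
Qed.

(** * Closed form and zeros of the eigenvalues *)

(** The geometric sum over [-m <= s <= m] gives [x^(2m+1) - 1]; the absent term [s = 0] takes off
    [x^(m+1) - x^m]. *)
Lemma sum_expr_inv (F : fieldType) (x : F) (m : nat) : x != 0 ->
  x ^+ m * (x - 1) * (\sum_(s <- iota 1 m) (x ^+ s + x^-1 ^+ s))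
    = x ^+ (2 * m + 1) - x ^+ m.+1 + x ^+ m - 1.
Proof.
move=> x0; elim: m => [|m IHm]; first by rewrite big_nil; ring.
rewrite -addn1 iotaD big_cat big_seq1 /= mulrDr.
have -> : x ^+ (m + 1) = x * x ^+ m by rewrite addn1 exprS.
rewrite -2!mulrA [x ^+ m * _]mulrA IHm add1n exprVn.
have -> : (2 * (m + 1) + 1 = 3 + m + m)%N by lia.
have -> : (2 * m + 1 = m + m + 1)%N by lia.
have xm0 : x ^+ m != 0 by rewrite expf_neq0.
by rewrite !exprS !exprD; field; apply/andP.
Qed.

Lemma gens_bound (t n : nat) : (4 * t + 4 <= n)%N ->
  all (fun s => (0 < s)%N && (s.*2 < n)%N) (gens t).
Proof. by move=> hn; apply/allP => s; rewrite mem_filter mem_iota; lia. Qed.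

(* [x ^+ (n - s)] stands for [x ^- s]: it is only meaningful when [x ^+ n = 1]. *)
Definition circ_eigenvalue (R : pzSemiRingType) (n t : nat) (x : R) : R :=
  \sum_(s <- gens t) (x ^+ s + x ^+ (n - s)).

Lemma circ_eigenvalue_curve (F : fieldType) (n t : nat) (x : F) :
  (0 < t)%N -> (4 * t + 4 <= n)%N -> x ^+ n = 1 ->
  x ^+ (2 * t + 1) * (x - 1) * circ_eigenvalue n t x = curve x (x ^+ t).
Proof.
move=> t0 hn xn.
have x0 : x != 0.
  by apply/eqP => E; move/eqP: xn; rewrite E expr0n gtn_eqF ?(eq_sym 0) ?oner_eq0 //; lia.
have sumE : circ_eigenvalue n t x
    = \sum_(s <- iota 1 (2 * t + 1)) (x ^+ s + x^-1 ^+ s) - (x ^+ t + x^-1 ^+ t).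
  rewrite (bigD1_seq t) ?iota_uniq ?mem_iota /=; try lia.
  rewrite addrC addrK -[RHS]big_filter; apply: eq_big_seq => s.
  move/(allP (gens_bound hn))/andP=> [_ s_n]; congr (_ + _).
  by apply: (mulIf (expf_neq0 s x0)); rewrite -exprD subnK ?xn -?exprMn ?mulVf ?expr1n //; lia.
rewrite sumE mulrBr sum_expr_inv // exprVn /curve.
have -> : (2 * (2 * t + 1) + 1 = t * 4 + 3)%N by lia.
have -> : (2 * t + 1 = t * 2 + 1)%N by lia.
rewrite exprS !exprD !exprM.
by field; rewrite expf_neq0.
Qed.

Lemma circ_eigenvalueN1 (F : numFieldType) (n t : nat) :
  (0 < t)%N -> odd t -> (4 * t + 4 <= n)%N -> ~~ odd n ->
  circ_eigenvalue n t (-1 : F) = 0.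
Proof.
move=> t0 odd_t hn evn.
have N1n : (-1 : F) ^+ n = 1 by rewrite -signr_odd (negPf evn).
apply: (mulfI (x := (-1) ^+ (2 * t + 1) * (-1 - 1) : F)).
  by rewrite mulf_neq0 ?signr_eq0 // -opprD oppr_eq0 -mulr2n pnatr_eq0.
rewrite circ_eigenvalue_curve // -(signr_odd _ t) odd_t /curve; ring.
Qed.

(** At 1 the factor [x - 1] makes the closed form void, but the sum is twice the number of
    generators, and [t + 1] is one. *)
Lemma circ_eigenvalue1 (F : numFieldType) (n t : nat) :
  (0 < t)%N -> circ_eigenvalue n t (1 : F) != 0.
Proof.
move=> t0; rewrite /circ_eigenvalue.
under eq_bigr => s _ do rewrite !expr1n -mulr2n.
rewrite -natr_sum pnatr_eq0 sum_nat_seq_neq0; apply/hasP; exists t.+1 => //.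
rewrite mem_filter mem_iota; lia.
Qed.

Lemma circ_eigenvalue_eq0 (n t : nat) (x : algC) :
  (3 <= t)%N -> odd t -> t != 1 %[mod 10] -> t != 15 %[mod 18] ->
  ~~ odd n -> (4 * t + 4 <= n)%N -> x ^+ n = 1 ->
  (circ_eigenvalue n t x == 0) = (x == -1).
Proof.
move=> t3 odd_t t10 t18 evn hn xn; have t_gt0 : (0 < t)%N by lia.
apply/eqP/eqP => [lam0|->]; last exact: circ_eigenvalueN1.
apply: (curve_root_of_unity _ odd_t t10 t18 xn); first lia.
  by apply: contra_eq_neq lam0 => ->; apply: circ_eigenvalue1.
by rewrite -(circ_eigenvalue_curve t_gt0 hn xn) lam0 mulr0.
Qed.

(** * Multiplicity of the eigenvalue 0 and the kernel vector *)

Lemma mup_map (F K : fieldType) (f : {rmorphism F -> K}) (x : F) (p : {poly F}) :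
  p != 0 -> mup (f x) (map_poly f p) = mup x p.
Proof.
move=> p0; have fp0 : map_poly f p != 0 by rewrite map_poly_eq0.
have geqE m : (m <= mup (f x) (map_poly f p))%N = (m <= mup x p)%N.
  by rewrite !mup_geq // -map_polyXsubC -rmorphXn dvdp_map.
by apply/eqP; rewrite eqn_leq -geqE leqnn geqE leqnn.
Qed.

Lemma char_poly_similar (F : fieldType) (n : nat) (A B P : 'M[F]_n) :
  P \in unitmx -> A *m P = P *m B -> char_poly A = char_poly B.
Proof.
move=> Pu AP; rewrite /char_poly.
have detP0 : \det (map_mx polyC P) != 0.
  by rewrite det_map_mx polyC_eq0 -unitfE -unitmxE.
apply: (mulIf detP0); rewrite -det_mulmx mulrC -det_mulmx; congr (\det _).
by rewrite /char_poly_mx mulmxBl mulmxBr -!map_mxM AP scalar_mxC.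
Qed.

(** The columns of the Vandermonde matrix of the [n]-th roots of unity are Fourier vectors, so it
    diagonalizes the adjacency matrix; [lam k] vanishes only for [z^k = -1], that is [k = n/2]. *)
Lemma mup_circ (n t : nat) :
  (3 <= t)%N -> odd t -> t != 1 %[mod 10] -> t != 15 %[mod 18] ->
  ~~ odd n -> (4 * t + 4 <= n)%N ->
  mup 0 (char_poly (\matrix_(i, j < n) (circ (gens t) i j)%:R : 'M[algC]_n)) = 1%N.
Proof.
move=> t3 odd_t t10 t18 evn hn; have n_gt0 : (0 < n)%N by lia.
have [z zP] := C_prim_root_exists n_gt0.
have zkn k : (z ^+ k) ^+ n = 1 by rewrite -exprM mulnC exprM (prim_expr_order zP) expr1n.
pose lam k := circ_eigenvalue n t (z ^+ k).
pose V := Vandermonde n (\row_(k < n) z ^+ k).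
pose D := diag_mx (\row_(k < n) lam k).
have Vu : V \in unitmx.
  rewrite unitmxE unitfE det_Vandermonde; apply/prodf_neq0 => i _.
  apply/prodf_neq0 => j ij; rewrite !mxE subr_eq0 (eq_prim_root_expr zP).
  by rewrite !modn_small // gtn_eqF.
rewrite (char_poly_similar (B := D) Vu); last first.
  apply/matrixP => i k; rewrite mul_mx_diag !mxE mulrC -sum_circ ?gens_bound //.
    by apply: eq_bigr => j _; rewrite !mxE.
  by rewrite filter_uniq ?iota_uniq.
rewrite char_poly_trig ?diag_mx_is_trig //.
rewrite -(big_map (fun k => D k k) predT (fun y => 'X - y%:P)) mu_prod_XsubC.
have half_n : (n./2 < n)%N by lia.
have zhalf : z ^+ n./2 = -1.
  have /eqP : z ^+ n./2 ^+ 2 = 1 by rewrite -exprM muln2 even_halfK ?(prim_expr_order zP).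
  rewrite sqrf_eq1 -(prim_order_dvd zP) gtnNdvd => [/eqP|| ] //; lia.
rewrite count_map -sum1_count (big_pred1 (Ordinal half_n)) // => k /=.
rewrite !mxE eqxx mulr1n circ_eigenvalue_eq0 // -zhalf (eq_prim_root_expr zP).
by rewrite !modn_small.
Qed.

Lemma simple_circ (n : nat) (S : seq nat) :
  all (fun s => (0 < s)%N && (s.*2 < n)%N) S -> simple_graph (@circ n S).
Proof.
move=> boundS; split=> [i j | i].
  rewrite /circ; apply: eq_has => s.
  by rewrite orbC ![(_ + _ == _ %[mod n])%N]eq_sym.
apply/negP => /hasP[s /(allP boundS)/andP[s_gt0 s_n]].
rewrite [X in _ || X]eq_sym orbb modn_eq_add //; lia.
Qed.

(* Both characteristic polynomials come from [rat], and [mup] is invariant under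
   field morphisms, so the Fourier diagonalization can be done over [algC]. *)
Lemma mup_adjmx_circ (R : rcfType) (n : nat) (S : seq nat) :
  mup 0 (char_poly (adjmx R (@circ n S)))
    = mup 0 (char_poly (\matrix_(i, j < n) (circ S i j)%:R : 'M[algC]_n)).
Proof.
have ratE (K : numFieldType) :
    mup 0 (char_poly (\matrix_(i, j < n) (circ S i j)%:R : 'M[K]_n))
      = mup 0 (char_poly (\matrix_(i, j < n) (circ S i j)%:R : 'M[rat]_n)).
  rewrite -[RHS](mup_map (ratr : {rmorphism rat -> K})) ?monic_neq0 ?char_poly_monic //.
  rewrite rmorph0 map_char_poly; congr (mup 0 (char_poly _)).
  by apply/matrixP => i j; rewrite !mxE rmorph_nat.
by rewrite /adjmx !ratE.
Qed.

(** This is the Fourier vector at [x = -1], which has entries in [R] itself. *)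
Lemma adjmx_circ_alternating (R : rcfType) (n t : nat) :
  (0 < t)%N -> odd t -> (4 * t + 4 <= n)%N -> ~~ odd n ->
  adjmx R (@circ n (gens t)) *m (\col_(i < n) (-1) ^+ i) = 0.
Proof.
move=> t_gt0 odd_t hn evn; apply/colP => i; rewrite !mxE.
transitivity (circ_eigenvalue n t (-1) * (-1) ^+ i : R); last first.
  by rewrite circ_eigenvalueN1 ?mul0r.
rewrite -sum_circ ?gens_bound ?filter_uniq ?iota_uniq //.
  by apply: eq_bigr => j _; rewrite !mxE.
by rewrite -signr_odd (negPf evn).
Qed.

Local Close Scope ring_scope.

Theorem theorem9 (R : rcfType) (t n : nat) (ht3 : 3 <= t) (htodd : odd t)
  (ht10 : t != 1 %[mod 10]) (ht18 : t != 15 %[mod 18])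
  (hneven : ~~ odd n) (hn : 4 * t + 4 <= n) :
  nut_graph R (@circ n (gens t)).
Proof.
split; first exact: simple_circ (gens_bound hn).
- by lia.
- by rewrite mup_adjmx_circ mup_circ.
exists (\col_(i < n) (-1) ^+ i)%R => [|i]; last by rewrite mxE signr_eq0.
by apply: adjmx_circ_alternating => //; lia.
Qed.
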